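(* Let $n\ge2$ and $i\ge0$ be integers, let $L_{n,0}=\sqrt{n^2-1}$, $\omega_n=n+\sqrt{n^2-1}$, and $\alpha=\frac{c_{i,n}\omega_n}{d_{i+1,n}}$. Then $$C_{L_{n,0}}(\alpha)\ \ge\ \sqrt{\frac{\alpha}{2L_{n,0}}}\ >\ \sup_{j\ge0}\Gamma_{\alpha,L_{n,0}}(A_{j,n}).$$
   Context: For $a,b>0$ let $E(a,b)=\{(w,z)\in\mathbb C^2: \frac{\pi|w|^2}{a}+\frac{\pi|z|^2}{b}\le 1\}$ and $P(a,b)=\{(w,z)\in\mathbb C^2:\pi|w|^2\le a,\ \pi|z|^2\le b\}$, with the standard symplectic form on $\mathbb C^2=\mathbb R^4$. For $\alpha,\beta\ge1$, $C_\beta(\alpha)=\inf\{\lambda>0:\text{there is a symplectic embedding }E(1,\alpha)\hookrightarrow P(\lambda,\lambda\beta)\}$. Define $\vec v_{i,n}=(a_{i,n},b_{i,n},c_{i,n},d_{i,n})\in\mathbb Z^4$ by $\vec v_{0,n}=(1,0,1,1)$, $\vec v_{1,n}=(n,1,2n+1,1)$, $\vec v_{i+2,n}=2n\vec v_{i+1,n}-\vec v_{i,n}$, and let $A_{i,n}$ denote the class $(a_{i,n},b_{i,n};\mathcal W(c_{i,n},d_{i,n}))$. Set $\Gamma_{\alpha,\beta}(A_{j,n})=\frac{d_{j,n}\alpha}{a_{j,n}+\beta b_{j,n}}$ if $\alpha\le\frac{c_{j,n}}{d_{j,n}}$, and $\Gamma_{\alpha,\beta}(A_{j,n})=\frac{c_{j,n}}{a_{j,n}+\beta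 b_{j,n}}$ if $\alpha\ge\frac{c_{j,n}}{d_{j,n}}$ (so it depends only on the four integers; $\mathcal W(c,d)$ is just notation here). *)

(* Defs.v *)
From HB Require Import structures.
From mathcomp Require Import all_boot all_order all_algebra.
From mathcomp Require Import all_classical all_reals all_analysis.
Import Order.TTheory GRing.Theory Num.Theory.
Import numFieldNormedType.Exports.

Set Implicit Arguments.
Unset Strict Implicit.
Unset Printing Implicit Defensive.

Local Open Scope classical_set_scope.
Local Open Scope ring_scope.

(* A point (w, z) of C^2 = R^4 is the row vector (Re w, Im w, Re z, Im z). *)

Definition ellipsoid (R : realType) (a b : R) : set 'rV[R]_4 :=
  [set x | pi * (x 0 0 ^+ 2 + x 0 1 ^+ 2) / a
           + pi * (x 0 2 ^+ 2 + x 0 3 ^+ 2) / b <= 1].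

Definition polydisk (R : realType) (a b : R) : set 'rV[R]_4 :=
  [set x | pi * (x 0 0 ^+ 2 + x 0 1 ^+ 2) <= a
           /\ pi * (x 0 2 ^+ 2 + x 0 3 ^+ 2) <= b].

Definition omega0 (R : realType) (u v : 'rV[R]_4) : R :=
  (u 0 0 * v 0 1 - u 0 1 * v 0 0) + (u 0 2 * v 0 3 - u 0 3 * v 0 2).

(* Meant for open U: all iterated directional derivatives up to order k exist
   and are continuous at every point of U. *)
Fixpoint Ck_on (R : realType) (k : nat) (U : set 'rV[R]_4)
    (f : 'rV[R]_4 -> 'rV[R]_4) : Prop :=
  match k with
  | 0%N => forall x, U x -> {for x, continuous f}
  | k'.+1 => (forall x, U x -> differentiable f x)
             /\ forall v, Ck_on k' U (fun x => 'D_v f x)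
  end.

Definition smooth_on (R : realType) (U : set 'rV[R]_4)
    (f : 'rV[R]_4 -> 'rV[R]_4) : Prop :=
  forall k, Ck_on k U f.

(* Meant for X compact and equal to the closure of its interior.  A map is
   smooth on X if it is the restriction of a smooth map on an open
   neighbourhood of X; its differential at points of X does not depend on the
   extension.  Preservation of omega0 makes f an immersion, and an injective
   immersion of a compact X is an embedding. *)
Definition symplectic_embedding (R : realType) (X Y : set 'rV[R]_4)
    (f : 'rV[R]_4 -> 'rV[R]_4) : Prop :=
  [/\ exists U : set 'rV[R]_4, [/\ open U, X `<=` U & smooth_on U f],
      {in X &, injective f},
      forall x, X x ->
        forall u v, omega0 ('d f x u) ('d f x v) = omega0 u v
    & forall x, X x -> Y (f x)].

Definition embedding_capacity (R : realType) (beta alpha : R) : R :=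
  inf [set lambda : R | 0 < lambda
    /\ exists f, symplectic_embedding (ellipsoid 1 alpha)
                   (polydisk lambda (lambda * beta)) f].

(* The vector (a_{i,n}, b_{i,n}, c_{i,n}, d_{i,n}). *)
Fixpoint vvec (n i : nat) : int * int * int * int :=
  match i with
  | 0%N => (1, 0, 1, 1)
  | i'.+1 =>
    match i' with
    | 0%N => (n%:Z, 1, (2 * n + 1)%N%:Z, 1)
    | i''.+1 => vvec n i' *+ (2 * n) - vvec n i''
    end
  end.

Definition avec (n i : nat) : int := (vvec n i).1.1.1.
Definition bvec (n i : nat) : int := (vvec n i).1.1.2.
Definition cvec (n i : nat) : int := (vvec n i).1.2.
Definition dvec (n i : nat) : int := (vvec n i).2.

(* Gamma_{alpha,beta}(A_{j,n}); the two formulas agree at alpha = c / d. *)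
Definition Gamma (R : realType) (alpha beta : R) (n j : nat) : R :=
  let a := (avec n j)%:~R in
  let b := (bvec n j)%:~R in
  let c := (cvec n j)%:~R in
  let d := (dvec n j)%:~R in
  if alpha <= c / d then d * alpha / (a + beta * b) else c / (a + beta * b).

Definition Ln0 (R : realType) (n : nat) : R := Num.sqrt (n%:R ^+ 2 - 1).

Definition omega_n (R : realType) (n : nat) : R :=
  n%:R + Num.sqrt (n%:R ^+ 2 - 1).

Definition alpha_in (R : realType) (n i : nat) : R :=
  (cvec n i)%:~R * omega_n R n / (dvec n i.+1)%:~R.

(* Main.v *)
(** The volume inequality [vol (ellipsoid 1 alpha) <= vol (polydisk lambda
    (lambda * beta))] gives the lower bound on the capacity.  It is derived from
    a covering argument which uses neither the inverse function theorem nor the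
    measurability of the images of [f]: if [x0] is a point of the compact set
    [E] that [f] maps into a grid cell of side [h], and the linear
    approximation at [x0] holds up to [eps * h], then the part of [E] that [f]
    maps into this cell is contained in the parallelepiped [f x0 + df_x0 (y -
    x0) \in (1 + 2 eps)-enlarged cell], whose volume is [((1 + 2 eps) h)^4]
    because [|det df_x0| = 1].  Every point of [E] is eventually such a good
    point as [h -> 0], because the inverse of an injective continuous map on a
    compact set is continuous.

    The strict inequality is explicit: with [w = n + sqrt (n^2 - 1)] the
    supremum is at most [c_i / w^i], and
    [2 L c_i d_(i+1) = w^(2i+1) - w^-(2i+1)]. *)

From HB Require Import structures.
Require Import Defs.
From mathcomp Require Import all_boot all_order all_algebra.
From mathcomp Require Import all_classical all_reals all_analysis.
From mathcomp Require Import fingroup perm measurable_realfun ring lra.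
Import Order.TTheory GRing.Theory Num.Theory.
Import numFieldNormedType.Exports.
Local Open Scope classical_set_scope.
Local Open Scope ring_scope.

Set Implicit Arguments.
Unset Strict Implicit.

(** * The obstructions *)

Section Recurrence.
Variables (R : realType) (n : nat).
Hypothesis hn : (2 <= n)%N.
Local Notation L := (Ln0 R n).
Local Notation w := (omega_n R n).
Local Notation v := (n%:R - L).

Let n_ge2 : 2 <= n%:R :> R. Proof. by rewrite ler_nat. Qed.

Lemma sqr_Ln0 : L ^+ 2 = n%:R ^+ 2 - 1.
Proof. by rewrite sqr_sqrtr //; have := n_ge2; nra. Qed.

Lemma Ln0_gt0 : 0 < L.
Proof. by rewrite sqrtr_gt0; have := n_ge2; nra. Qed.

Lemma omega_nE : w = n%:R + L. Proof. by []. Qed.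

Lemma omega_n_gt1 : 1 < w.
Proof. by rewrite omega_nE; have := n_ge2; have := Ln0_gt0; lra. Qed.

Lemma omega_n_conj : w * v = 1.
Proof.
have := sqr_Ln0; rewrite omega_nE => h.
by transitivity (n%:R ^+ 2 - L ^+ 2); [ring | rewrite h; ring].
Qed.

(** [w] and [v] are the roots of x^2 - 2 n x + 1, so both geometric sequences satisfy the
    recurrence, and two initial values determine the combination. *)
Lemma linear_recurrenceE (u : nat -> R) (A B : R) :
  (forall i, u i.+2 = 2 * n%:R * u i.+1 - u i) ->
  u 0%N = A + B -> u 1%N = A * w + B * v ->
  forall i, u i = A * w ^+ i + B * v ^+ i.
Proof.
move=> uS u0 u1 i; suff [] : u i = A * w ^+ i + B * v ^+ i /\
  u i.+1 = A * w ^+ i.+1 + B * v ^+ i.+1 by [].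
elim: i => [|i [IH0 IH1]]; first by rewrite !expr0 !expr1 !mulr1.
split=> //; rewrite uS IH0 IH1.
have -> : 2 * n%:R = w + v by rewrite omega_nE; ring.
have := omega_n_conj; rewrite !exprS; set x := w; set y := v => xy.
transitivity (A * (x * (x * x ^+ i) + (x * y - 1) * x ^+ i)
  + B * (y * (y * y ^+ i) + (x * y - 1) * y ^+ i)); first by ring.
by rewrite xy; ring.
Qed.

Lemma vvec_step i : vvec n i.+2 = vvec n i.+1 *+ (2 * n) - vvec n i.
Proof. by []. Qed.

Let intr_step (x y : int) :
  (x *+ (2 * n) - y)%:~R = 2 * n%:R * x%:~R - y%:~R :> R.
Proof. by rewrite rmorphB rmorphMn /= -mulr_natl natrM. Qed.

(** At [beta = L] the denominator of [Gamma] starts with 1 and n + L = [w], so its [v] component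
    vanishes and a pure power of [w] remains. *)
Lemma avec_bvecE i : (avec n i)%:~R + L * (bvec n i)%:~R = w ^+ i :> R.
Proof.
transitivity (1 * w ^+ i + 0 * v ^+ i); last by rewrite mul1r mul0r addr0.
apply: (@linear_recurrenceE (fun i => (avec n i)%:~R + L * (bvec n i)%:~R)).
- move=> j; rewrite /avec /bvec vvec_step /= !raddfMn /= !intr_step; ring.
- by rewrite /avec /bvec /=; ring.
- by rewrite /avec /bvec /= mulr1 mul0r addr0 mul1r.
Qed.

Lemma cvecE i : (cvec n i)%:~R * (w - 1) = w ^+ i.+1 - v ^+ i :> R.
Proof.
transitivity (w * w ^+ i + -1 * v ^+ i); last by rewrite exprS mulN1r.
apply: (@linear_recurrenceE (fun i => (cvec n i)%:~R * (w - 1))).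
- move=> j; rewrite /cvec vvec_step /= !raddfMn /= !intr_step; ring.
- by rewrite /cvec /=; ring.
- rewrite /cvec /= -[X in X * _]/((2 * n + 1)%:R) natrD natrM.
  have := sqr_Ln0; rewrite omega_nE => h; apply/eqP; rewrite -subr_eq0; apply/eqP.
  by transitivity (n%:R ^+ 2 - 1 - L ^+ 2); [ring | rewrite h subrr].
Qed.

Lemma dvecE i : (dvec n i)%:~R * (w + 1) = w ^+ i + w * v ^+ i :> R.
Proof.
transitivity (1 * w ^+ i + w * v ^+ i); last by rewrite mul1r.
apply: (@linear_recurrenceE (fun i => (dvec n i)%:~R * (w + 1))).
- move=> j; rewrite /dvec vvec_step /= !raddfMn /= !intr_step; ring.
- by rewrite /dvec /=; ring.
- by rewrite /dvec /= omega_n_conj; ring.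
Qed.

Let w_gt0 : 0 < w. Proof. by have := omega_n_gt1; lra. Qed.

Let vE : v = w^-1.
Proof. by apply: (mulfI (lt0r_neq0 w_gt0)); rewrite omega_n_conj divff ?lt0r_neq0. Qed.

Let v_gt0 : 0 < v. Proof. by rewrite vE invr_gt0. Qed.
Let v_lt1 : v < 1. Proof. by rewrite vE invf_lt1 ?omega_n_gt1. Qed.

(** Written this way, the quotient depends on [i] only through [v ^+ (2 * i)], which decreases
    because 0 < [v] < 1. This gives the monotonicity of [c_i / w^i], and likewise of [d_i / w^i]. *)
Lemma cvec_divE i :
  (cvec n i)%:~R / w ^+ i = (w - v ^+ (2 * i)) / (w - 1) :> R.
Proof.
have h1 : w - 1 != 0 by have := omega_n_gt1; lra.
have hw : w ^+ i != 0 by rewrite expf_neq0 // lt0r_neq0.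
apply: (mulIf h1); rewrite mulrAC cvecE divfK // mulrBl exprS mulfK //.
by rewrite vE mulnC exprM expr2 !exprVn.
Qed.

Lemma dvec_divE i :
  (dvec n i)%:~R / w ^+ i = (1 + w * v ^+ (2 * i)) / (w + 1) :> R.
Proof.
have h1 : w + 1 != 0 by have := omega_n_gt1; lra.
have hw : w ^+ i != 0 by rewrite expf_neq0 // lt0r_neq0.
apply: (mulIf h1); rewrite mulrAC dvecE divfK // mulrDl divff // -mulrA.
by rewrite vE mulnC exprM expr2 !exprVn.
Qed.

Lemma cvec_gt0 i : 0 < (cvec n i)%:~R :> R.
Proof.
rewrite -(pmulr_rgt0 _ (_ : 0 < w - 1)); last by have := omega_n_gt1; lra.
rewrite mulrC cvecE subr_gt0; apply: (@le_lt_trans _ _ 1).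
  by rewrite exprn_ile1 // ltW.
by rewrite exprn_egt1 // omega_n_gt1.
Qed.

Lemma dvec_gt0 i : 0 < (dvec n i)%:~R :> R.
Proof.
rewrite -(pmulr_rgt0 _ (_ : 0 < w + 1)); last by have := omega_n_gt1; lra.
by rewrite mulrC dvecE addr_gt0 ?mulr_gt0 ?exprn_gt0.
Qed.

Lemma cvec_div_le j i : (j <= i)%N ->
  (cvec n j)%:~R / w ^+ j <= (cvec n i)%:~R / w ^+ i :> R.
Proof.
move=> ji; rewrite !cvec_divE ler_wpM2r ?invr_ge0 ?subr_ge0 ?(ltW omega_n_gt1) //.
by rewrite lerB //; apply: ler_wiXn2l; rewrite ?ltW // leq_mul2l.
Qed.

Lemma dvec_div_le j i : (i <= j)%N ->
  (dvec n j)%:~R / w ^+ j <= (dvec n i)%:~R / w ^+ i :> R.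
Proof.
move=> ji; rewrite !dvec_divE; apply: ler_wpM2r.
  by rewrite invr_ge0 addr_ge0 // ltW.
by rewrite lerD2l ler_pM2l //; apply: ler_wiXn2l; rewrite ?ltW // leq_mul2l.
Qed.

Lemma alpha_in_gt0 i : 0 < alpha_in R n i.
Proof. by rewrite divr_gt0 ?mulr_gt0 ?cvec_gt0 ?dvec_gt0. Qed.

(* [Gamma] is the minimum of [d_j alpha / w^j], which decreases in [j], and
   [c_j / w^j], which increases; at [alpha_in n i] they cross between [i] and
   [i.+1], with common value [c_i / w^i]. *)
Lemma Gamma_le i j :
  Gamma (alpha_in R n i) L n j <= (cvec n i)%:~R / w ^+ i.
Proof.
have G_le_d : Gamma (alpha_in R n i) L n j
    <= (dvec n j)%:~R / w ^+ j * alpha_in R n i.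
  rewrite /Gamma avec_bvecE; case: ifPn; first by rewrite mulrAC.
  rewrite -ltNge ltr_pdivrMr ?dvec_gt0 // => /ltW h.
  by rewrite mulrAC; apply: ler_wpM2r; rewrite 1?mulrC // invr_ge0 exprn_ge0 // ltW.
have G_le_c : Gamma (alpha_in R n i) L n j <= (cvec n j)%:~R / w ^+ j.
  rewrite /Gamma avec_bvecE; case: ifPn => //.
  rewrite ler_pdivlMr ?dvec_gt0 // => h.
  by apply: ler_wpM2r; rewrite 1?mulrC // invr_ge0 exprn_ge0 // ltW.
have [ji|ij] := leqP j i.
  exact: le_trans G_le_c (cvec_div_le ji).
apply: (le_trans G_le_d).
(* At index [i.+1] the factor [d_(i+1)] cancels against the denominator of [alpha_in n i]. *)
apply: (@le_trans _ _ ((dvec n i.+1)%:~R / w ^+ i.+1 * alpha_in R n i)).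
  by apply: ler_wpM2r; [rewrite ltW // alpha_in_gt0 | exact: dvec_div_le].
have := dvec_gt0 i.+1; rewrite /alpha_in exprS; have := w_gt0.
set x := w; set d := _%:~R; set c := _%:~R => x0 d0.
rewrite le_eqVlt; apply/orP; left; apply/eqP; field.
by rewrite !lt0r_neq0 ?exprn_gt0.
Qed.

(** Squaring and clearing denominators turns the claim into [key]. The factor 2 L [w] = ([w] -
    1)([w] + 1) absorbs the denominators of the closed forms of [c_i] and [d_(i+1)]. *)
Lemma cvec_div_lt_sqrt i :
  (cvec n i)%:~R / w ^+ i < Num.sqrt (alpha_in R n i / (2 * L)).
Proof.
have w1 := omega_n_gt1; have L0 := Ln0_gt0.
have c0 := cvec_gt0 i; have d0 := dvec_gt0 i.+1.
have wi0 : 0 < w ^+ i by rewrite exprn_gt0.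
have key : 2 * L * (cvec n i)%:~R * (dvec n i.+1)%:~R < w * (w ^+ i) ^+ 2 :> R.
  have LE : 2 * L * w = (w - 1) * (w + 1).
    have := sqr_Ln0; rewrite omega_nE => h.
    apply/eqP; rewrite -subr_eq0; apply/eqP.
    by transitivity (L ^+ 2 - (n%:R ^+ 2 - 1)); [ring | rewrite h subrr].
  rewrite -(ltr_pM2r w_gt0).
  have -> : 2 * L * (cvec n i)%:~R * (dvec n i.+1)%:~R * w =
      (w ^+ i.+1 - v ^+ i) * (w ^+ i.+1 + w * v ^+ i.+1).
    rewrite -cvecE -dvecE -[LHS]mulrA.
    move: ((cvec n i)%:~R : R) ((dvec n i.+1)%:~R : R) w (L) LE => c d x y LE.
    by transitivity (2 * y * x * c * d); [ring | rewrite LE; ring].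
  (* The two factors become [w ^+ i.+1 - v ^+ i] and [w ^+ i.+1 + v ^+ i], so their product is a
     difference of squares. *)
  have -> : w * v ^+ i.+1 = v ^+ i by rewrite exprS mulrA omega_n_conj mul1r.
  have -> : w * (w ^+ i) ^+ 2 * w = (w ^+ i.+1) ^+ 2 by rewrite [w ^+ i.+1]exprS; ring.
  have : 0 < (v ^+ i) ^+ 2 by rewrite !exprn_gt0.
  by set p := w ^+ i.+1; set q := v ^+ i => q0; rewrite -subr_sqr; lra.
have c_ge0 : 0 <= (cvec n i)%:~R / w ^+ i :> R by rewrite divr_ge0 ?ltW.
rewrite -(ger0_norm c_ge0) -sqrtr_sqr ltr_sqrt ?divr_gt0 ?alpha_in_gt0 ?mulr_gt0 //.
rewrite expr_div_n /alpha_in -[X in _ < X]mulrA -invfM.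
rewrite ltr_pdivrMr ?exprn_gt0 // mulrAC ltr_pdivlMr ?mulr_gt0 //.
rewrite -(ltr_pM2l c0) in key.
by apply: le_lt_trans (lt_le_trans key _);
  rewrite le_eqVlt; apply/orP; left; apply/eqP; ring.
Qed.

(** Strictness survives the supremum because the bound [c_i / w^i] is uniform in [j]. *)
Lemma ereal_sup_Gamma_lt i :
  (ereal_sup [set (Gamma (alpha_in R n i) L n j)%:E | j in [set: nat]]
    < (Num.sqrt (alpha_in R n i / (2 * L)))%:E)%E.
Proof.
apply: (@le_lt_trans _ _ ((cvec n i)%:~R / w ^+ i)%:E).
  by apply: ge_ereal_sup => _ [j _ <-]; rewrite lee_fin Gamma_le.
by rewrite lte_fin cvec_div_lt_sqrt.
Qed.

End Recurrence.

(** * Linear images of Lebesgue measure on R^4 *)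

(** Stated with preimages, which a measurable map keeps measurable; the factor [k] is therefore the
    inverse of the absolute Jacobian of [phi]. *)
Definition scales d (T : measurableType d) (R : realType)
    (mu : set T -> \bar R) (k : R) (phi : T -> T) : Prop :=
  measurable_fun setT phi /\
  forall S, measurable S -> mu (phi @^-1` S) = (k%:E * mu S)%E.

Section Scales.
Context d (T : measurableType d) (R : realType).
Implicit Type mu : set T -> \bar R.

Lemma scales_comp mu k l phi psi :
  scales mu k phi -> scales mu l psi -> scales mu (k * l) (psi \o phi).
Proof.
move=> [mphi kphi] [mpsi lpsi]; split; first exact: measurableT_comp.
move=> S mS; rewrite comp_preimage kphi ?lpsi ?EFinM ?muleA //.
by rewrite -[X in measurable X]setTI; exact: mpsi.
Qed.

End Scales.

(** * Iterated product measures and skew maps *)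

Section ProductSigmaFinite.
Context d1 d2 (T1 : measurableType d1) (T2 : measurableType d2) (R : realType).
Variable m1 : {sigma_finite_measure set T1 -> \bar R}.
Variable m2 : {sigma_finite_measure set T2 -> \bar R}.
Local Open Scope ereal_scope.

(* Unlike [m1 \x m2] itself, this name carries a sigma-finite structure, so that
   products can be iterated. *)
Definition prod_measure : set (T1 * T2)%type -> \bar R := m1 \x m2.

HB.instance Definition _ := Measure.on prod_measure.

Lemma prod_measureX A B : measurable A -> measurable B ->
  prod_measure (A `*` B) = m1 A * m2 B.
Proof. exact: product_measure1E. Qed.

Let prod_measure_sigma_finite : sigma_finite setT prod_measure.
Proof.
have /sigma_finiteP[F [TF ndF Foo]] := sigma_finiteT m1.
have /sigma_finiteP[G [TG ndG Goo]] := sigma_finiteT m2.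
exists (fun n => F n `*` G n) => [|k].
  apply/seteqP; split=> [[x y] _|//].
  have [i _ Fx] : (\bigcup_i F i) x by rewrite -TF.
  have [j _ Gy] : (\bigcup_j G j) y by rewrite -TG.
  exists (maxn i j) => //; split => /=.
    by apply: (subsetPset _ _ (ndF _ _ (leq_maxl i j))).
  by apply: (subsetPset _ _ (ndG _ _ (leq_maxr i j))).
have [mF Fk] := Foo k; have [mG Gk] := Goo k.
split; first exact: measurableX.
by rewrite prod_measureX // lte_mul_pinfty // ge0_fin_numE.
Qed.

HB.instance Definition _ := Measure_isSigmaFinite.Build _ _ _ prod_measure
  prod_measure_sigma_finite.

(** The product measure is defined by integrating the sections in the other direction. The two
    iterated integrals agree on rectangles, hence everywhere by uniqueness. *)
Lemma prod_measure_ysection S : measurable S ->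
  prod_measure S = \int[m2]_y m1 (ysection S y).
Proof.
move=> mS; rewrite -[RHS]/((m1 \x^ m2) S).
by apply: product_measure_unique => // A B mA mB; exact: product_measure2E.
Qed.

(** Cavalieri's principle: the map preserves each slice over a fixed [x] and scales the measure of
    every slice by the same factor. *)
Lemma scales_skew_right (k : R) (psi : T1 -> T2 -> T2) : (0 <= k)%R ->
  measurable_fun setT (fun p : T1 * T2 => (p.1, psi p.1 p.2)) ->
  (forall x, scales m2 k (psi x)) ->
  scales prod_measure k (fun p => (p.1, psi p.1 p.2)).
Proof.
move=> k0 mpsi kpsi; split=> // S mS.
transitivity (\int[m1]_x (k%:E * m2 (xsection S x))).
  apply: eq_integral => x _ /=.
  rewrite -(proj2 (kpsi x)); last exact: measurable_xsection.
  by rewrite !xsectionE.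
rewrite ge0_integralZl_EFin //; exact: measurable_fun_xsection.
Qed.

Lemma scales_skew_left (k : R) (psi : T2 -> T1 -> T1) : (0 <= k)%R ->
  measurable_fun setT (fun p : T1 * T2 => (psi p.2 p.1, p.2)) ->
  (forall y, scales m1 k (psi y)) ->
  scales prod_measure k (fun p => (psi p.2 p.1, p.2)).
Proof.
move=> k0 mpsi kpsi; split=> // S mS.
have mS' : measurable ((fun p : T1 * T2 => (psi p.2 p.1, p.2)) @^-1` S).
  by rewrite -[X in measurable X]setTI; exact: mpsi.
rewrite !prod_measure_ysection //.
transitivity (\int[m2]_y (k%:E * m1 (ysection S y))).
  apply: eq_integral => y _ /=.
  rewrite -(proj2 (kpsi y)); last exact: measurable_ysection.
  by rewrite !ysectionE.
rewrite ge0_integralZl_EFin //; exact: measurable_fun_ysection.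
Qed.

End ProductSigmaFinite.
Section LebesgueAffine.
Variable R : realType.
Local Notation mR := (measurableTypeR R).
Local Notation leb := (@lebesgue_measure R).

Lemma scales_affine (a b : R) : a != 0 ->
  scales leb (`|a|^-1) (fun x : mR => a * x + b : mR).
Proof.
move=> a0; have na0 : 0 < `|a| by rewrite normr_gt0.
have mphi : measurable_fun setT (fun x : mR => a * x + b : mR).
  by apply: measurable_funD => //; exact: measurable_funM.
split=> // S mS.
(* It suffices that [|a|] times the pushforward is Lebesgue measure, which is determined by its
   values on half-open intervals. For negative [a] the preimage has its open end on the other side,
   which does not change its length. *)
pose nu := pushforward (mscale (NngNum (ltW na0)) leb) (fun x : mR => a * x + b : mR).
suff -> : leb S = nu S.
  by rewrite /nu /mscale /pushforward /= muleA -EFinM mulVf ?mul1e ?lt0r_neq0.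
apply: lebesgue_measure_unique => // _ [[u v] _ <-] /=.
rewrite /pushforward /mscale /=.
have [{}a0|a_lt0|/eqP] := ltgtP 0 a; last by rewrite eq_sym (negbTE a0).
- rewrite (_ : _ @^-1` _ = [set` `](u - b) / a, (v - b) / a]]); last first.
    apply/seteqP; split=> x /=; rewrite !in_itv /= => /andP[h1 h2];
      move: h1 h2; rewrite ?ltr_pdivrMr ?ler_pdivlMr // mulrC => h1 h2;
      apply/andP; split; lra.
  rewrite !lebesgue_measure_itv /= !lte_fin ltr_pM2r ?invr_gt0 // ltrD2r.
  case: ifPn => _; last by rewrite mule0.
  by rewrite -!EFinD -EFinM gtr0_norm //; congr EFin; field; rewrite lt0r_neq0.
- rewrite (_ : _ @^-1` _ = [set` `[(v - b) / a, (u - b) / a[]); last first.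
    apply/seteqP; split=> x /=; rewrite !in_itv /= => /andP[h1 h2];
      move: h1 h2; rewrite ?ltr_ndivlMr ?ler_ndivrMr // mulrC => h1 h2;
      apply/andP; split; lra.
  rewrite !lebesgue_measure_itv /= !lte_fin ltr_nM2r ?invr_lt0 // ltrD2r.
  case: ifPn => _; last by rewrite mule0.
  by rewrite -!EFinD -EFinM ltr0_norm //; congr EFin; field; rewrite ltr0_neq0.
Qed.

End LebesgueAffine.

(** * Factorisation of invertible matrices into column matrices *)

Section ColumnMatrices.
Variables (F : fieldType) (n : nat).
Implicit Types A B : 'M[F]_n.+1.

(** Acting on row vectors from the right, such a matrix changes the coordinate [j] only. *)
Definition column_mx (j : 'I_n.+1) A : Prop :=
  forall i k, k != j -> A i k = (i == k)%:R.

(** The cofactors along column [j] do not see that column, so they are those of the identity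
    matrix. *)
Lemma det_column_mx j A : column_mx j A -> \det A = A j j.
Proof.
move=> Aj; rewrite (expand_det_col _ j) (bigD1 j) //= big1 ?addr0 => [|i ij].
  suff -> : cofactor A j j = 1 by rewrite mulr1.
  rewrite (_ : cofactor A j j = cofactor 1%:M j j); last first.
    rewrite /cofactor; congr (_ * \det (row' _ _)); apply/matrixP => i k.
    by rewrite !mxE Aj // eq_sym neq_lift.
  by have := adj1 F n.+1 => /matrixP/(_ j j); rewrite !mxE eqxx.
rewrite (_ : cofactor A i j = cofactor 1%:M i j); last first.
  rewrite /cofactor; congr (_ * \det (row' _ _)); apply/matrixP => r k.
  by rewrite !mxE Aj // eq_sym neq_lift.
by have := adj1 F n.+1 => /matrixP/(_ j i); rewrite !mxE eq_sym (negbTE ij) => ->;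
  rewrite mulr0.
Qed.

Variable K : 'M[F]_n.+1 -> Prop.
Hypothesis K_mul : forall A B, K A -> K B -> K (A *m B).
Hypothesis K_column : forall j A, column_mx j A -> A j j != 0 -> K A.

Let K1 : K 1%:M.
Proof. by apply: (@K_column 0) => [i k _|]; rewrite mxE // oner_neq0. Qed.

(* The ranking [r] selects upper or lower triangular matrices. *)
Lemma triangular_ind (r : 'I_n.+1 -> nat) A : injective r ->
  (forall i k, i != k -> (r k <= r i)%N -> A i k = 0) ->
  (forall i, A i i != 0) -> K A.
Proof.
(* No rank reaches [M], so at the start it holds vacuously that all columns of rank at least [M] are
   those of the identity. The induction lowers this bound by splitting off one column at a time. *)
move=> r_inj; pose M := (\max_i r i).+1.
have : forall i k, (M <= r k)%N -> A i k = (i == k)%:R.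
  by move=> i k; rewrite leqNgt ltnS leq_bigmax.
elim: M A => [|m IH] A Aid Atri Ad.
  by rewrite (_ : A = 1%:M) //; apply/matrixP => i k; rewrite Aid // mxE.
have [[j rj]|nj] := pselect (exists j, r j = m); last first.
  apply: IH => // i k; rewrite leq_eqVlt => /orP[/eqP mk|/Aid //].
  by case: nj; exists k.
(* Off the diagonal, row [j] vanishes by triangularity at smaller ranks and by the induction bound
   at larger ones. This is what makes the factorisation [A = C *m A'] exact. *)
have Aj k : k != j -> A j k = 0.
  move=> kj; have [rkj|rjk] := leqP (r k) (r j).
    by apply: Atri => //; rewrite eq_sym.
  by rewrite Aid 1?eq_sym ?(negbTE kj) // -rj.
pose C : 'M[F]_n.+1 := \matrix_(i, k) if k == j then A i k else (i == k)%:R.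
pose A' : 'M[F]_n.+1 := \matrix_(i, k) if k == j then (i == k)%:R else A i k.
have -> : A = C *m A'.
  apply/matrixP => i k; rewrite mxE (bigD1 j) //= !mxE eqxx.
  have [->|kj] := eqVneq k j.
    rewrite ?eqxx mulr1 big1 ?addr0 // => l lj.
    by rewrite !mxE eqxx (negbTE lj) mulr0.
  rewrite Aj // mulr0 add0r; have [->|ij] := eqVneq i j.
    by rewrite Aj // big1 // => l lj; rewrite !mxE (negbTE lj) eq_sym (negbTE lj) mul0r.
  rewrite (bigD1 i) //= !mxE (negbTE ij) (negbTE kj) eqxx mul1r big1 ?addr0 //.
  by move=> l /andP[lj li]; rewrite !mxE (negbTE lj) eq_sym (negbTE li) mul0r.
apply: K_mul.
  apply: (@K_column j); last by rewrite mxE eqxx.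
  by move=> i k kj; rewrite mxE (negbTE kj).
apply: IH => [i k|i k ik rki|i]; rewrite mxE.
- case: eqVneq => // kj; rewrite leq_eqVlt => /orP[/eqP mk|/Aid //].
  by move: kj; rewrite (r_inj k j) ?eqxx // rj.
- by case: eqVneq => [kj|_]; [rewrite (negbTE ik) | apply: Atri].
- by case: (eqVneq i j) => [ij|//]; rewrite eqxx oner_neq0.
Qed.

(** Three shears exchange the two coordinates up to one sign, which the diagonal factor corrects.
    Each of the four factors is a column matrix. *)
Lemma tperm_mx_shears (i j : 'I_n.+1) : i != j ->
  tperm_mx i j = (1 + delta_mx i j) * (1 - delta_mx j i)
    * (1 + delta_mx i j) * (1 - delta_mx i i *+ 2) :> 'M[F]_n.+1.
Proof.
move=> ij; have ji : j != i by rewrite eq_sym.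
have dd k l k' l' : (delta_mx k l : 'M[F]_n.+1) * delta_mx k' l' =
    delta_mx k l' *+ (l == k') by exact: mul_delta_mx_cond.
transitivity (1 + delta_mx i j + delta_mx j i - delta_mx i i - delta_mx j j
    : 'M[F]_n.+1).
  apply/matrixP => k l; rewrite !mxE.
  case: tpermP => [->|->|/eqP ki /eqP kj]; rewrite ?eqxx /=.
  - rewrite (negbTE ij) /= [i == l]eq_sym [j == l]eq_sym.
    by case: (l == i); case: (l == j) => /=; ring.
  - rewrite (negbTE ji) /= [i == l]eq_sym [j == l]eq_sym.
    by case: (l == i); case: (l == j) => /=; ring.
  - by rewrite (negbTE ki) (negbTE kj) /=; ring.
have S1 : (1 + delta_mx i j) * (1 - delta_mx j i) =
    1 + delta_mx i j - delta_mx j i - delta_mx i i :> 'M[F]_n.+1.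
  by rewrite mulrDl mul1r mulrDr mulr1 mulrN dd eqxx mulr1n addrA [1 - _ + _]addrAC.
have S2 : (1 + delta_mx i j - delta_mx j i - delta_mx i i) * (1 + delta_mx i j) =
    1 + delta_mx i j - delta_mx j i - delta_mx i i - delta_mx j j :> 'M[F]_n.+1.
  rewrite mulrDr mulr1 !mulrBl mulrDl mul1r !dd !eqxx (negbTE ji) !mulr1n mulr0n addr0.
  by rewrite [delta_mx i j - _ - _]addrAC subrr add0r.
have S3 : (1 + delta_mx i j - delta_mx j i - delta_mx i i - delta_mx j j)
    * delta_mx i i = - delta_mx j i :> 'M[F]_n.+1.
  rewrite !mulrBl mulrDl mul1r !dd !eqxx (negbTE ji) !mulr1n !mulr0n addr0 subr0.
  by rewrite addrAC subrr add0r.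
rewrite S1 S2 mulrBr mulr1 mulrnAr S3 mulNrn opprK mulr2n.
rewrite -![_ - delta_mx i i - delta_mx j j]addrA.
set X := - delta_mx i i - delta_mx j j; rewrite [RHS]addrAC; congr (_ + _).
by rewrite addrA subrK.
Qed.

Let K_shear (i j : 'I_n.+1) a : i != j -> K (1 + a *: delta_mx i j).
Proof.
move=> ij; apply: (@K_column j) => [k l lj|]; rewrite !mxE ?eqxx.
  by rewrite (negbTE lj) andbF mulr0 addr0.
by rewrite [j == i]eq_sym (negbTE ij) mulr0 addr0 oner_neq0.
Qed.

Let K_tperm (i j : 'I_n.+1) : K (tperm_mx i j).
Proof.
have [->|ij] := eqVneq i j; first by rewrite /tperm_mx tperm1 perm_mx1.
rewrite tperm_mx_shears //; apply: K_mul; [apply: K_mul; [apply: K_mul |] |].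
- by rewrite -[delta_mx i j]scale1r; exact: K_shear.
- by rewrite -scaleN1r; apply: K_shear; rewrite eq_sym.
- by rewrite -[delta_mx i j]scale1r; exact: K_shear.
apply: (@K_column i) => [k l li|]; rewrite !mxE ?eqxx.
  by rewrite (negbTE li) andbF /= ?mulr2n !addr0 subr0.
by rewrite /= ?mulr2n opprD addrA subrr sub0r oppr_eq0 oner_neq0.
Qed.

Let K_perm s : K (perm_mx s).
Proof.
have [ts -> _] := prod_tpermP s.
elim: ts => [|t ts IH]; first by rewrite big_nil perm_mx1; exact: K1.
by rewrite big_cons perm_mxM; apply: K_mul => //; exact: K_tperm.
Qed.

(** The LUP decomposition reduces the claim to permutations, which are products of transpositions
    and hence of shears and reflections, and to triangular matrices with nonzero diagonal. *)
Lemma unitmx_column_ind A : A \in unitmx -> K A.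
Proof.
move=> Au; have := cormen_lup_correct A; have := cormen_lup_detL A.
have := cormen_lup_perm A; have := cormen_lup_lower A.
have := @cormen_lup_upper _ _ A; case: cormen_lup => [[P L] U] /=.
move=> Uup Llow /is_perm_mxP[s ->] detL PA.
have -> : A = perm_mx s^-1 *m (L *m U).
  rewrite -[L *m U]/(L * U) -PA -[_ * A]/(_ *m A) mulmxA -perm_mxM.
  by rewrite mulVg perm_mx1 mul1mx.
apply: K_mul => //; apply: K_mul.
  apply: (@triangular_ind (fun i => n - i)%N) => [i j /= h|i k ik ki|i].
  - by apply: val_inj; rewrite /= -(subKn (ltn_ord i : (i <= n)%N)) h subKn // -ltnS.
  - rewrite Llow ?(negbTE ik) //; move: ki; rewrite leq_sub2lE // -ltnS //.
  - by rewrite Llow // eqxx oner_neq0.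
have Unz : forall i, U i i != 0.
  have : \det U != 0.
    apply: contraTneq Au => U0; rewrite unitmxE unitfE negbK.
    have : \det (perm_mx s *m A) = 0 by rewrite -[_ *m A]/(_ * A) PA det_mulmx U0 mulr0.
    by rewrite det_mulmx det_perm => /eqP; rewrite mulf_eq0 signr_eq0.
  rewrite -det_tr det_trig ?prodf_seq_neq0 => [/allP nz i|].
    by have := nz i; rewrite mem_index_enum mxE; apply.
  by apply/is_trig_mxP => i j ij; rewrite mxE Uup.
apply: (@triangular_ind (fun i => i : nat)) => // [i j /val_inj //|i k ik ki].
by rewrite Uup // ltn_neqAle ki andbT eq_sym.
Qed.

End ColumnMatrices.

Lemma ord4P (i : 'I_4) : [\/ i = 0, i = 1, i = 2 | i = 3].
Proof.
by case: i => -[|[|[|[|i]]]] hi //;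
  [apply: Or41 | apply: Or42 | apply: Or43 | apply: Or44]; exact: val_inj.
Qed.

(** * Scaling of Lebesgue measure by the determinant; boxes *)

Section LinearScaling.
Variable R : realType.
Local Notation mR := (measurableTypeR R).
Local Notation T2 := (mR * mR)%type.
Local Notation T4 := (T2 * T2)%type.
Local Notation leb := (@lebesgue_measure R).

Local Notation leb2 := (prod_measure leb leb).
Local Notation leb4 := (prod_measure leb2 leb2).

(** Measures live on nested pairs, the geometry on row vectors; a set of row vectors is measured
    through its preimage under [rvec]. *)
Definition rvec (p : T4) : 'rV[R]_4 :=
  \row_i [:: p.1.1; p.1.2; p.2.1; p.2.2]`_i.

Definition quad (y : 'rV[R]_4) : T4 := ((y 0 0, y 0 1), (y 0 2, y 0 3)).

Lemma quadK : cancel quad rvec.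
Proof.
move=> y; apply/rowP => -[[|[|[|[|i]]]] hi] //; rewrite mxE /=;
  by congr (y 0 _); apply: val_inj.
Qed.

Definition linmap (A : 'M[R]_4) (p : T4) : T4 := quad (rvec p *m A).

Lemma linmapE (A : 'M[R]_4) p j : (rvec p *m A) 0 j =
  p.1.1 * A 0 j + p.1.2 * A 1 j + p.2.1 * A 2 j + p.2.2 * A 3 j.
Proof.
rewrite mxE !big_ord_recl big_ord0 !mxE /= addr0 !addrA.
by congr (_ * A _ _ + _ * A _ _ + _ * A _ _ + _ * A _ _); apply: val_inj.
Qed.

Let meas11 : measurable_fun setT (fun p : T4 => p.1.1).
Proof. exact: (measurableT_comp measurable_fst). Qed.
Let meas12 : measurable_fun setT (fun p : T4 => p.1.2).
Proof. exact: (measurableT_comp measurable_snd). Qed.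
Let meas21 : measurable_fun setT (fun p : T4 => p.2.1).
Proof. exact: (measurableT_comp measurable_fst). Qed.
Let meas22 : measurable_fun setT (fun p : T4 => p.2.2).
Proof. exact: (measurableT_comp measurable_snd). Qed.

Lemma measurable_linmap A : measurable_fun setT (linmap A).
Proof.
suff mA j : measurable_fun setT (fun p : T4 => (rvec p *m A) 0 j : mR).
  by apply: measurable_fun_pair; apply: measurable_fun_pair.
rewrite (_ : (fun _ => _) = fun p : T4 =>
    p.1.1 * A 0 j + p.1.2 * A 1 j + p.2.1 * A 2 j + p.2.2 * A 3 j); last first.
  by apply/funext => p; rewrite linmapE.
by do !apply: measurable_funD; apply: measurable_funM.
Qed.

Lemma scales_affine_fst a b c : a != 0 ->
  scales leb2 (`|a|^-1) (fun z : T2 => (a * z.1 + (b * z.2 + c), z.2) : T2).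
Proof.
move=> a0; apply: (@scales_skew_left _ _ mR mR R leb leb _
  (fun y x : mR => a * x + (b * y + c) : mR)) => //.
  apply: measurable_fun_pair => //.
  by apply: measurable_funD; [|apply: measurable_funD => //]; apply: measurable_funM.
by move=> y; exact: scales_affine.
Qed.

Lemma scales_affine_snd a b c : a != 0 ->
  scales leb2 (`|a|^-1) (fun z : T2 => (z.1, a * z.2 + (b * z.1 + c)) : T2).
Proof.
move=> a0; apply: (@scales_skew_right _ _ mR mR R leb leb _
  (fun x y : mR => a * y + (b * x + c) : mR)) => //.
  apply: measurable_fun_pair => //.
  by apply: measurable_funD; [|apply: measurable_funD => //]; apply: measurable_funM.
by move=> x; exact: scales_affine.
Qed.

(** The single changed coordinate is affine in itself with slope [A j j], the other coordinates
    entering as an offset. So the map is skew between the two pairs and again inside one pair. *)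
Lemma scales_linmap_column j A : column_mx j A -> A j j != 0 ->
  scales leb4 (`|A j j|^-1) (linmap A).
Proof.
move=> AE Ajj; have mA := measurable_linmap A; move: mA.
case: (ord4P j) => jE; subst j.
- pose psi (z w : T2) : T2 :=
    (A 0 0 * w.1 + (A 1 0 * w.2 + (A 2 0 * z.1 + A 3 0 * z.2)), w.2).
  have -> : linmap A = fun p => (psi p.2 p.1, p.2).
    apply/funext => -[[x y] [z t]]; rewrite /linmap /quad !linmapE
      !(AE _ 1) // !(AE _ 2) // !(AE _ 3) // /psi /=.
    by apply: (congr2 pair); apply: (congr2 pair) => /=; ring.
  move=> mA; apply: (@scales_skew_left _ _ _ _ R leb2 leb2 _ psi) => // z.
  exact: scales_affine_fst.
- pose psi (z w : T2) : T2 :=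
    (w.1, A 1 1 * w.2 + (A 0 1 * w.1 + (A 2 1 * z.1 + A 3 1 * z.2))).
  have -> : linmap A = fun p => (psi p.2 p.1, p.2).
    apply/funext => -[[x y] [z t]]; rewrite /linmap /quad !linmapE
      !(AE _ 0) // !(AE _ 2) // !(AE _ 3) // /psi /=.
    by apply: (congr2 pair); apply: (congr2 pair) => /=; ring.
  move=> mA; apply: (@scales_skew_left _ _ _ _ R leb2 leb2 _ psi) => // z.
  exact: scales_affine_snd.
- pose psi (w z : T2) : T2 :=
    (A 2 2 * z.1 + (A 3 2 * z.2 + (A 0 2 * w.1 + A 1 2 * w.2)), z.2).
  have -> : linmap A = fun p => (p.1, psi p.1 p.2).
    apply/funext => -[[x y] [z t]]; rewrite /linmap /quad !linmapE
      !(AE _ 0) // !(AE _ 1) // !(AE _ 3) // /psi /=.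
    by apply: (congr2 pair); apply: (congr2 pair) => /=; ring.
  move=> mA; apply: (@scales_skew_right _ _ _ _ R leb2 leb2 _ psi) => // z.
  exact: scales_affine_fst.
- pose psi (w z : T2) : T2 :=
    (z.1, A 3 3 * z.2 + (A 2 3 * z.1 + (A 0 3 * w.1 + A 1 3 * w.2))).
  have -> : linmap A = fun p => (p.1, psi p.1 p.2).
    apply/funext => -[[x y] [z t]]; rewrite /linmap /quad !linmapE
      !(AE _ 0) // !(AE _ 1) // !(AE _ 2) // /psi /=.
    by apply: (congr2 pair); apply: (congr2 pair) => /=; ring.
  move=> mA; apply: (@scales_skew_right _ _ _ _ R leb2 leb2 _ psi) => // z.
  exact: scales_affine_snd.
Qed.

Lemma scales_linmap A : A \in unitmx -> scales leb4 (`|\det A|^-1) (linmap A).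
Proof.
apply: (@unitmx_column_ind _ _ (fun A => scales leb4 (`|\det A|^-1) (linmap A))).
  move=> B C sB sC; have -> : linmap (B *m C) = linmap C \o linmap B.
    by apply/funext => p; rewrite /linmap /= quadK mulmxA.
  by rewrite det_mulmx normrM invfM; exact: scales_comp.
move=> j B Bj Bjj; rewrite (det_column_mx Bj); exact: scales_linmap_column.
Qed.

(** The flag selects the upper end: [true] gives half-open boxes, which tile the space, and [false]
    gives closed ones, used for the enlarged cells. *)
Definition box (b : bool) (y : 'rV[R]_4) (s : R) : set 'rV[R]_4 :=
  [set x | forall i, x 0 i \in Interval (BLeft (y 0 i)) (BSide b (y 0 i + s))].

Local Notation side b y s i := [set` Interval (BLeft (y 0 i)) (BSide b (y 0 i + s))].

Lemma box_quad b y s : rvec @^-1` box b y s =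
  (side b y s 0 `*` side b y s 1) `*` (side b y s 2 `*` side b y s 3).
Proof.
apply/seteqP; split=> [[[x1 x2] [x3 x4]] /= h|[[x1 x2] [x3 x4]] /=].
  by have := h 0; have := h 1; have := h 2; have := h 3; rewrite !mxE /=.
move=> [[h0 h1] [h2 h3]] i.
by case: (ord4P i) => ->; rewrite mxE.
Qed.

Lemma measurable_box b y s : measurable (rvec @^-1` box b y s).
Proof. by rewrite box_quad; do !apply: measurableX. Qed.

Lemma leb4_box b y s : 0 < s -> leb4 (rvec @^-1` box b y s) = (s ^+ 4)%:E.
Proof.
move=> s0; rewrite box_quad.
have sideE i : leb (side b y s i) = s%:E.
  rewrite lebesgue_measure_itv /= lte_fin ltrDl s0 -EFinD.
  by rewrite [_ + s]addrC addrK.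
have rectE i j : leb2 (side b y s i `*` side b y s j) = (s * s)%:E.
  rewrite [LHS]prod_measureX; [|exact: measurable_itv..].
  by apply: (eq_trans (congr2 _ (sideE _) (sideE _))); rewrite -EFinM.
rewrite [LHS]prod_measureX; [|exact: measurableX..].
apply: (eq_trans (congr2 _ (rectE _ _) (rectE _ _))).
by rewrite -EFinM; congr EFin; ring.
Qed.

End LinearScaling.

(** * The covering argument *)

Section RowNorm.
Variable R : realType.

Lemma coord_le_norm n (y : 'rV[R]_n) i : `|y 0 i| <= `|y|.
Proof.
rewrite [leRHS]/Num.norm /= mx_normrE.
by apply/bigmax_geP; right; exists (0, i).
Qed.

Lemma norm_le_coord n (y : 'rV[R]_n) r : 0 <= r ->
  (forall i, `|y 0 i| <= r) -> `|y| <= r.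
Proof.
move=> r0 yr; rewrite [leLHS]/Num.norm /= mx_normrE.
by apply/bigmax_leP; split=> //= -[i j] _ /=; rewrite (ord1 i).
Qed.

Lemma mulmx_bounded n (B : 'M[R]_n) :
  exists2 C, 0 < C & forall v : 'rV[R]_n, `|v *m B| <= C * `|v|.
Proof.
exists (1 + \sum_i \sum_j `|B i j|).
  by rewrite ltr_wpDr // sumr_ge0 // => i _; apply: sumr_ge0.
move=> v; apply: norm_le_coord => [|j].
  by rewrite mulr_ge0 // addr_ge0 // sumr_ge0 // => i _; apply: sumr_ge0.
rewrite mxE (le_trans (ler_norm_sum _ _ _)) //.
rewrite mulrDl mul1r -[leLHS]add0r lerD // mulr_suml ler_sum // => i _.
rewrite normrM mulrC ler_pM ?coord_le_norm //.
by rewrite (bigD1 j) //= lerDl sumr_ge0.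
Qed.

End RowNorm.

Section CountableCover.
Context d (T : measurableType d) (R : realType) (mu : {measure set T -> \bar R}).
Local Open Scope ereal_scope.

(** The sets [X i] are disjoint, so their measures add up to that of the union; for the [Y i]
    countable subadditivity suffices. *)
Lemma measure_countable_union_le (I : countType) (X Y : I -> set T) (c : R) :
  (0 <= c)%R -> (forall i, measurable (X i)) -> (forall i, measurable (Y i)) ->
  (forall i j x, X i x -> X j x -> i = j) ->
  (forall i, mu (Y i) <= c%:E * mu (X i)) ->
  measurable (\bigcup_i Y i) /\
  mu (\bigcup_i Y i) <= c%:E * mu (\bigcup_i X i).
Proof.
move=> c0 mX mY X_disj YX.
(* Reindexing by natural numbers, with the empty set at numbers that encode no index. *)
pose nX (n : nat) := oapp X set0 (pickle_inv n : option I).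
pose nY (n : nat) := oapp Y set0 (pickle_inv n : option I).
have unionE (Z : I -> set T) :
    \bigcup_i Z i = \bigcup_n oapp Z set0 (pickle_inv n : option I).
  apply/seteqP; split=> x [i _ Zx].
    by exists (pickle i) => //; rewrite pickleK_inv.
  by move: Zx; case: pickle_inv => // j Zx; exists j.
have mnX (n : nat) : measurable (nX n) by rewrite /nX; case: pickle_inv => /=.
have mnY (n : nat) : measurable (nY n) by rewrite /nY; case: pickle_inv => /=.
rewrite !unionE -/nX -/nY; have mUY := bigcupT_measurable _ mnY; split=> //.
have triv : trivIset setT nX.
  apply/trivIsetP => i j _ _ /eqP ij; apply/seteqP; split=> // x [].
  rewrite /nX; have := @pickle_invK I i; have := @pickle_invK I j.
  case: pickle_inv => //= b bj; case: pickle_inv => //= a ai Xa Xb.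
  by apply: ij; rewrite -bj -ai (X_disj _ _ _ Xa Xb).
apply: (@le_trans _ _ (\sum_(n <oo) mu (nY n))).
  exact: measure_sigma_subadditive.
rewrite measure_semi_bigcup //; last exact: bigcupT_measurable.
rewrite -nneseriesZl; last by move=> n _; exact: measure_ge0.
apply: lee_nneseries => [n _ _|n _]; first exact: measure_ge0.
by rewrite /nX /nY; case: pickle_inv => //=; rewrite !measure0 mule0.
Qed.

End CountableCover.

(** * Continuity of the inverse and linear approximation on a compact set *)

Section InverseEstimates.
Variables (R : realType) (n : nat).
Implicit Types (f : 'rV[R]_n.+1 -> 'rV[R]_n.+1) (E : set 'rV[R]_n.+1).

(** The points of [E] at distance at least [rho] from [x] form a compact set; its image is closed
    and, by injectivity, misses [f x]. *)
Lemma compact_injective_inverse f E x rho : compact E ->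
  (forall y, E y -> {for y, continuous f}) -> {in E &, injective f} ->
  E x -> 0 < rho ->
  exists2 delta, 0 < delta &
    forall y, E y -> `|f y - f x| < delta -> `|y - x| < rho.
Proof.
move=> cE fc finj Ex rho0; pose K := E `&` ~` ball x rho.
have cK : compact K.
  apply: (subclosed_compact _ cE) => [|y []//].
  apply: closedI; last by apply: open_closedC; exact: ball_open.
  by apply: compact_closed => //; exact: norm_hausdorff.
have cfK : compact (f @` K).
  apply: continuous_compact cK; apply: continuous_in_subspaceT => y /set_mem[Ey _].
  exact: fc.
have /nbhs_ballP[delta /= delta0 sub] : nbhs (f x) (~` (f @` K)).
  apply: open_nbhs_nbhs; split.
    by apply: closed_openC; apply: compact_closed => //; exact: norm_hausdorff.
  move=> [y [Ey xy] fyx]; have yx : y = x by apply: finj => //; exact: mem_set.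
  by apply: xy; rewrite yx; exact: ballxx.
exists delta => // y Ey yx.
apply: contrapT => /negP; rewrite -leNgt => rho_le.
apply: (sub (f y)); first by rewrite -ball_normE /= distrC.
by exists y => //; split=> //=; rewrite -ball_normE /= distrC; apply/negP; rewrite -leNgt.
Qed.

(** The error is measured against [f y - f x] rather than [y - x]: the invertible differential
    bounds [y - x] by its own value there, which differs from [f y - f x] by the error itself. *)
Lemma differential_remainder f E x eps : compact E ->
  (forall y, E y -> {for y, continuous f}) -> {in E &, injective f} ->
  E x -> differentiable f x -> lin1_mx ('d f x) \in unitmx -> 0 < eps ->
  exists2 delta, 0 < delta & forall y, E y -> `|f y - f x| < delta ->
    `|f y - f x - 'd f x (y - x)| <= eps * `|f y - f x|.
Proof.
move=> cE fc finj Ex dfx Au eps0; set A := lin1_mx _ in Au.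
have [C C0 CP] := mulmx_bounded (invmx A).
have dE h : 'd f x h = h *m A by rewrite mul_rV_lin1.
have lower h : `|h| <= C * `|'d f x h|.
  by rewrite dE -{1}[h](mulmxK Au); exact: CP.
(* The bound 1/2 on [kappa * C] lets the remainder be absorbed, giving [rn <= F]; the bound
   [eps / 2] then yields [eps / 2 * (F + F)], which is [eps * F]. *)
pose kappa := Num.min (2^-1) (eps / 2) / C.
have kappa0 : 0 < kappa by rewrite divr_gt0 // lt_min invr_gt0 ltr0n divr_gt0.
have /eqaddoP/(_ _ kappa0)/nbhs_ballP[rho /= rho0 rhoP] := diff_locally dfx.
have [delta delta0 deltaP] := compact_injective_inverse cE fc finj Ex rho0.
exists delta => // y Ey /(deltaP _ Ey) yx.
have : `|f y - f x - 'd f x (y - x)| <= kappa * `|y - x|.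
  have := rhoP (y - x); rewrite -ball_normE /= sub0r normrN => /(_ yx).
  by rewrite !fctE /= subrK opprD addrA.
set r := f y - f x - _ => rle.
have dle : `|'d f x (y - x)| <= `|f y - f x| + `|r|.
  by have -> : 'd f x (y - x) = f y - f x - r;
    [rewrite /r opprB addrCA subrr addr0 | exact: ler_normB].
have := lower (y - x); set h := `|y - x| in rle *; set dn := `|'d f x _| in dle *.
set F := `|f y - f x| in dle *; set rn := `|r| in rle dle * => hle.
have kC : kappa * C = Num.min 2^-1 (eps / 2) by rewrite divfK ?lt0r_neq0.
have kC1 : kappa * C <= 2^-1 by rewrite kC ge_min lexx.
have kC2 : kappa * C <= eps / 2 by rewrite kC ge_min lexx orbT.
have F0 : 0 <= F by exact: normr_ge0.
have rn0 : 0 <= rn by exact: normr_ge0.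
have r1 : rn <= kappa * C * (F + rn).
  apply: (le_trans rle); rewrite -mulrA ler_pM2l //.
  by apply: (le_trans hle); rewrite ler_pM2l.
have rF : rn <= F.
  have : rn <= 2^-1 * (F + rn) by apply: (le_trans r1); rewrite ler_wpM2r ?addr_ge0.
  lra.
apply: (le_trans r1); apply: (@le_trans _ _ (eps / 2 * (F + rn))).
  by rewrite ler_wpM2r ?addr_ge0.
have : eps / 2 * (F + rn) <= eps / 2 * (F + F) by rewrite ler_wpM2l ?lerD2l // ltW ?divr_gt0.
by move/le_trans; apply; rewrite -mulr2n -[F *+ 2]mulr_natr; lra.
Qed.

End InverseEstimates.

(** * Comparison of volumes through grid cells *)

Section Covering.
Variable R : realType.
Local Notation leb := (@lebesgue_measure R).
Local Notation leb2 := (prod_measure leb leb).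
Local Notation leb4 := (prod_measure leb2 leb2).

Lemma leb4_linear_box b (A : 'M[R]_4) u c s : 0 < s -> `|\det A| = 1 ->
  let S := rvec (R := R) @^-1` [set y | box b c s (u + y *m A)] in
  measurable S /\ leb4 S = (s ^+ 4)%:E.
Proof.
move=> s0 detA S; have Au : A \in unitmx.
  by rewrite unitmxE unitfE -normr_eq0 detA oner_neq0.
have [mA kA] := scales_linmap Au.
have -> : S = linmap A @^-1` (rvec (R := R) @^-1` box b (c - u) s).
  apply/seteqP; split=> p; rewrite /S /= /linmap quadK /box /= => h i;
    move: {h S}(h i); rewrite !mxE; case: b; rewrite !in_itv /= => /andP[h1 h2];
    apply/andP; split; lra.
have mB := measurable_box b (c - u) s; split.
  by rewrite -[X in measurable X]setTI; exact: mA.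
by rewrite kA // detA invr1 mul1e leb4_box.
Qed.

Definition corner (h : R) (k : 'rV[int]_4) : 'rV[R]_4 := \row_i ((k 0 i)%:~R * h).

Definition cell (h : R) (k : 'rV[int]_4) := box true (corner h k) h.

Definition cell_index (h : R) (y : 'rV[R]_4) : 'rV[int]_4 :=
  \row_i Num.floor (y 0 i / h).

Lemma cellP h k y : 0 < h -> cell h k y <-> k = cell_index h y.
Proof.
move=> h0; split=> [yk|->].
  apply/rowP => i; rewrite mxE; apply/esym/floor_def.
  have := yk i; rewrite in_itv /= mxE => /andP[h1 h2].
  rewrite ler_pdivlMr // h1 ltr_pdivrMr // intrD mulrDl mul1r h2 //.
move=> i; rewrite in_itv /= !mxE -ler_pdivlMr // floor_le /=.
by rewrite -[X in _ + X]mul1r -mulrDl -ltr_pdivrMr // -intrD1 floorD1_gt.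
Qed.

Lemma cell_diam h k y z : cell h k y -> cell h k z -> 0 < h -> `|y - z| <= h.
Proof.
move=> yk zk h0; apply: norm_le_coord => [|i]; first exact: ltW.
have := yk i; have := zk i; rewrite !in_itv /= !mxE => /andP[a1 a2] /andP[b1 b2].
by rewrite ler_norml; apply/andP; split; lra.
Qed.

Variables (f : 'rV[R]_4 -> 'rV[R]_4) (E Q : set 'rV[R]_4) (t delta : R).
Hypotheses (t1 : 1 < t) (delta0 : 0 < delta) (cE : compact E).
Hypothesis mE : measurable (rvec (R := R) @^-1` E).
Hypothesis mQ : measurable (rvec (R := R) @^-1` Q).
Hypothesis df : forall x, E x -> differentiable f x.
Hypothesis finj : {in E &, injective f}.
Hypothesis det_df : forall x, E x -> `|\det (lin1_mx ('d f x))| = 1.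
Hypothesis fEQ : forall x y, E x -> `|y - f x| <= delta -> Q y.

(** Chosen so that 1 + 2 [eps] = [t]: a cell of side [h] widened by [eps * h] on both sides has side
    [t * h]. *)
Let eps := (t - 1) / 2.
Let h (m : nat) : R := m.+1%:R^-1.

Let eps0 : 0 < eps. Proof. by rewrite divr_gt0 // subr_gt0. Qed.
Let h0 m : 0 < h m. Proof. by rewrite invr_gt0. Qed.

(** The condition is on the distance of the images, so that it covers all points of [E] sent into
    the same cell as [x]. *)
Let good m : set 'rV[R]_4 := [set x | E x /\ forall y, E y ->
  `|f y - f x| <= h m -> `|f y - f x - 'd f x (y - x)| <= eps * h m].

Let hits m k : set 'rV[R]_4 := [set x | good m x /\ cell (h m) k (f x)].

(* [cover m k] contains [good m `&` f @^-1` cell (h m) k], and has at most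
   [t ^+ 4] times the measure of the cell. *)
Let cover m k : set 'rV[R]_4 :=
  if `[< hits m k !=set0 >] then
    let x := xget 0 (hits m k) in
    [set y | box false (corner (h m) k - const_mx (eps * h m)) (t * h m)
               (f x - x *m lin1_mx ('d f x) + y *m lin1_mx ('d f x))]
  else set0.

(** A cell that contains the image of a good point stays within [h m] of that image, hence inside
    [Q] once [h m <= delta]; all other cells are dropped. *)
Let hit_cell m k := if `[< hits m k !=set0 >] then cell (h m) k else set0.

Let cover_measure m k :
  measurable (rvec (R := R) @^-1` cover m k) /\
  (leb4 (rvec (R := R) @^-1` cover m k)
    <= (t ^+ 4)%:E * leb4 (rvec (R := R) @^-1` hit_cell m k))%E.
Proof.
rewrite /cover /hit_cell; case: asboolP => [e|_]; last first.
  by rewrite !preimage_set0 !measure0 mule0.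
have [[Ex _] _] := xgetPex 0 e; set x := xget _ _ in Ex *.
have th0 : 0 < t * h m by rewrite mulr_gt0 // (lt_trans _ t1).
have [mS ->] := leb4_linear_box false
  (f x - x *m lin1_mx ('d f x)) (corner (h m) k - const_mx (eps * h m)) th0 (det_df Ex).
by split=> //; rewrite leb4_box // -EFinM -exprMn.
Qed.

Let good_cover m x : good m x -> cover m (cell_index (h m) (f x)) x.
Proof.
move=> gx; rewrite /cover; set k := cell_index _ _.
have xk : cell (h m) k (f x) by apply/cellP.
case: asboolP => [e|]; last by case; exists x.
have [[Ex' gx'] x'k] := xgetPex 0 e; set x' := xget _ _ in Ex' gx' x'k *.
have [Ex _] := gx; have := gx' _ Ex (cell_diam xk x'k (h0 m)).
set r := _ - _ => rle /= i; have := le_trans (coord_le_norm r i) rle.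
(* The affine approximation at the representative [x'], evaluated at [x], is [f x - r]. Since [f x]
   lies in the cell and [r] is at most [eps * h m], the value lies in the enlarged cell. *)
have -> : f x' - x' *m lin1_mx ('d f x') + x *m lin1_mx ('d f x') = f x - r.
  have -> : r = f x - f x' - (x - x') *m lin1_mx ('d f x') by rewrite mul_rV_lin1.
  rewrite mulmxBl; move: (x *m _) (x' *m _) (f x) (f x') => a b c d.
  by apply/rowP => l; rewrite !mxE; ring.
have := xk i; rewrite !in_itv /= !mxE ler_norml => /andP[h1 h2] /andP[h3 h4].
have tE : t * h m = h m + eps * h m *+ 2.
  by rewrite /eps -mulrnAl -[_ / 2 *+ 2]mulr_natr divfK ?pnatr_eq0 // mulrBl mul1r addrC subrK.
by rewrite tE; apply/andP; split; lra.
Qed.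

Let cover_m m : set 'rV[R]_4 := \bigcup_k cover m k.

Let cover_m_measure m : h m <= delta ->
  measurable (rvec (R := R) @^-1` cover_m m) /\
  (leb4 (rvec (R := R) @^-1` cover_m m)
    <= (t ^+ 4)%:E * leb4 (rvec (R := R) @^-1` Q))%E.
Proof.
move=> hd.
have mcell k : measurable (rvec (R := R) @^-1` hit_cell m k).
  rewrite /hit_cell; case: asboolP => _; first exact: measurable_box.
  by rewrite preimage_set0.
have disj k l p : hit_cell m k (rvec p) -> hit_cell m l (rvec p) -> k = l.
  rewrite /hit_cell; case: asboolP => // _; case: asboolP => // _.
  by move=> /(cellP _ _ (h0 m)) -> /(cellP _ _ (h0 m)).
have [mU le] := measure_countable_union_le (mu := leb4)
  (exprn_ge0 4 (ltW (lt_trans ltr01 t1))) mcell (fun k => proj1 (cover_measure m k))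
  disj (fun k => proj2 (cover_measure m k)).
rewrite /cover_m preimage_bigcup.
split; first exact: mU.
apply: (le_trans le).
apply: lee_wpmul2l; first by rewrite lee_fin exprn_ge0 // ltW // (lt_trans ltr01 t1).
have mUc : measurable (\bigcup_k (rvec (R := R) @^-1` hit_cell m k)).
  exact: countable_bigcupT_measurable.
apply: le_measure; [exact: mem_set | exact: mem_set | move=> p [k _] /=].
rewrite /hit_cell; case: asboolP => // -[x [[Ex _] xk]] pk.
by apply: (fEQ Ex); apply: le_trans hd; exact: cell_diam pk xk (h0 m).
Qed.

Let h_lt r : 0 < r -> exists N, forall m, (N <= m)%N -> h m < r.
Proof.
move=> r0; exists (Num.bound r^-1) => m Nm; rewrite invf_plt ?posrE //.
apply: (@lt_le_trans _ _ (Num.bound r^-1)%:R).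
  by apply: archi_boundP; rewrite invr_ge0 ltW.
by rewrite ler_nat; exact: leq_trans Nm (leqnSn _).
Qed.

(** The threshold [N] depends on [x], which is why the next estimate passes through tail
    intersections of the covers. *)
Let good_eventually x : E x -> exists N, forall m, (N <= m)%N -> good m x.
Proof.
move=> Ex; have Au : lin1_mx ('d f x) \in unitmx.
  by rewrite unitmxE unitfE -normr_eq0 det_df // oner_neq0.
have fc y : E y -> {for y, continuous f}.
  by move=> Ey; apply: differentiable_continuous; exact: df.
have [r r0 rP] := differential_remainder cE fc finj Ex (df Ex) Au eps0.
have [N NP] := h_lt r0; exists N => m /NP hr; split=> // y Ey yx.
apply: (le_trans (rP _ Ey (le_lt_trans yx hr))).
by rewrite ler_pM2l.
Qed.

(** Every point of [E] lies in all covers from some index on. Each tail intersection [F N] is no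
    larger than a single cover, and continuity from below passes the bound to their increasing
    union. *)
Lemma leb4_le_image :
  (leb4 (rvec (R := R) @^-1` E) <= (t ^+ 4)%:E * leb4 (rvec (R := R) @^-1` Q))%E.
Proof.
have [N0 N0P] := h_lt delta0.
have cP N := cover_m_measure (ltW (N0P _ (leq_addr N N0))).
pose F N := \bigcap_(j in [set j | (N <= j)%N]) (rvec (R := R) @^-1` cover_m (N0 + j)).
have mF N : measurable (F N).
  by apply: bigcap_measurable => [|j _]; [exists N => /= | exact: (cP j).1].
have mUF : measurable (\bigcup_N F N) by exact: bigcupT_measurable.
have ndF : nondecreasing_seq F.
  by move=> a b ab; apply/subsetPset => p Fp j /= bj; apply: Fp; exact: leq_trans bj.
have EF : rvec (R := R) @^-1` E `<=` \bigcup_N F N.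
  move=> p /= /good_eventually[N NP]; exists N => // j /= Nj.
  exists (cell_index (h (N0 + j)) (f (rvec p))) => //; apply: good_cover.
  by apply: NP; exact: leq_trans Nj (leq_addl _ _).
apply: (@le_trans _ _ (leb4 (\bigcup_N F N))).
  by apply: le_measure => //; exact: mem_set.
have cv := nondecreasing_cvg_mu (mu := leb4) mF mUF ndF.
rewrite -(cvg_lim _ cv) //; apply: lime_le; first by apply/cvg_ex; eexists; exact: cv.
apply: nearW => N /=; apply: le_trans (cP N).2.
apply: le_measure; [exact: mem_set | apply: mem_set; exact: (cP N).1 |].
by move=> p; apply => /=.
Qed.


End Covering.

(** * Volumes of ellipsoids and polydisks *)

Section Volumes.
Variable R : realType.
Local Notation mR := (measurableTypeR R).
Local Notation T2 := (mR * mR)%type.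
Local Notation T4 := (T2 * T2)%type.
Local Notation leb := (@lebesgue_measure R).
Local Notation leb2 := (prod_measure leb leb).
Local Notation leb4 := (prod_measure leb2 leb2).

Definition radius2 (z : T2) : R := pi * (z.1 ^+ 2 + z.2 ^+ 2).

Lemma measurable_radius2 : measurable_fun setT (radius2 : T2 -> mR).
Proof.
by apply: measurable_funM => //; apply: measurable_funD; apply: measurable_funX.
Qed.

Lemma measurable_sublevel d (T : measurableType d) (g : T -> mR) (t : R) :
  measurable_fun setT g -> measurable [set x | g x <= t].
Proof.
move=> mg; rewrite (_ : [set _ | _] = setT `&` g @^-1` `]-oo, t]); first exact: mg.
by rewrite setTI; apply/seteqP; split=> x /=; rewrite in_itv.
Qed.

Definition disc (t : R) : set T2 := [set z | radius2 z <= t].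

Lemma measurable_disc t : measurable (disc t).
Proof. exact: measurable_sublevel measurable_radius2. Qed.

Lemma scales_homothety (r : R) : 0 < r ->
  scales leb2 (r^-1 * r^-1) (fun z : T2 => (r * z.1, r * z.2) : T2).
Proof.
move=> r0; have rn0 : r != 0 by rewrite lt0r_neq0.
have := scales_comp (scales_affine_fst 0 0 rn0) (scales_affine_snd 0 0 rn0).
rewrite gtr0_norm // (_ : _ \o _ = fun z : T2 => (r * z.1, r * z.2) : T2) //.
by apply/funext => z; rewrite /= !mul0r !addr0.
Qed.

Lemma leb2_disc_scale t : 0 < t -> leb2 (disc t) = (t%:E * leb2 (disc 1))%E.
Proof.
(* The homothety of ratio [r] pulls the unit disc back to [disc t]. *)
move=> t0; set r := Num.sqrt t^-1; have r0 : 0 < r by rewrite sqrtr_gt0 invr_gt0.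
have r2 : r * r = t^-1 by rewrite -expr2 sqr_sqrtr // invr_ge0 ltW.
have [_ /(_ _ (measurable_disc 1))] := scales_homothety r0.
rewrite -invfM r2 invrK => <-; congr (leb2 _).
apply/funext => z; apply/propext; rewrite /disc /=.
have -> : radius2 (r * z.1, r * z.2) = radius2 z / t by rewrite -r2 /radius2 /=; ring.
by rewrite ler_pdivrMr // mul1r.
Qed.

Lemma leb2_disc1_lty : (leb2 (disc 1) < +oo)%E.
Proof.
have sub : disc 1 `<=` `[-1, 1] `*` `[-1, 1].
  move=> [x y]; rewrite /disc /radius2 /= => h; rewrite !in_itv /=.
  have p2 := pi_ge2 R.
  have : x ^+ 2 + y ^+ 2 <= 1.
    apply: le_trans h; rewrite -[leLHS]mul1r ler_wpM2r ?addr_ge0 ?sqr_ge0 //; lra.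
  by move=> xy; split; apply/andP; split; nra.
have mI : measurable (`[-1, 1] : set mR) by exact: measurable_itv.
apply: (@le_lt_trans _ _ (leb2 (`[-1, 1] `*` `[-1, 1]))).
  by apply: le_measure sub; apply/mem_set; [exact: measurable_disc | exact: measurableX].
rewrite prod_measureX //=; apply: lte_mul_pinfty => //.
  by rewrite lebesgue_measure_itv /= lte_fin; case: ifP.
by rewrite lebesgue_measure_itv /= lte_fin; case: ifP; rewrite -?EFinD ltry.
Qed.

Lemma leb2_disc1_gt0 : (0 < leb2 (disc 1))%E.
Proof.
have p0 := pi_gt0 R; pose r : R := Num.min 1 ((2 * pi)^-1).
have r0 : 0 < r by rewrite lt_min ltr01 invr_gt0 mulr_gt0.
have r1 : r <= 1 by rewrite ge_min lexx.
have rpi : 2 * pi * r <= 1.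
  by rewrite -ler_pdivlMl ?mulr_gt0 // mulr1 ge_min lexx orbT.
have sub : `[0, r] `*` `[0, r] `<=` disc 1.
  move=> [x y] /=; rewrite !in_itv /= => -[/andP[x0 xr] /andP[y0 yr]].
  rewrite /disc /radius2 /=; apply: le_trans rpi.
  rewrite [2 * pi]mulrC -mulrA ler_pM2l //; nra.
have mI : measurable (`[0, r] : set mR) by exact: measurable_itv.
apply: (@lt_le_trans _ _ (leb2 (`[0, r] `*` `[0, r]))); last first.
  apply: le_measure; [apply/mem_set | apply/mem_set | exact: sub].
    exact: measurableX.
  exact: measurable_disc.
rewrite prod_measureX //=; apply: mule_gt0;
  by rewrite lebesgue_measure_itv /= lte_fin r0 /= oppr0 adde0 lte_fin.
Qed.

(** Kept as a positive finite constant: both volumes carry the factor [disc_area ^+ 2], which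
    cancels in their comparison. *)
Definition disc_area : R := fine (leb2 (disc 1)).

Lemma disc_areaE : leb2 (disc 1) = disc_area%:E.
Proof. by rewrite /disc_area fineK // ge0_fin_numE ?leb2_disc1_lty. Qed.

Lemma disc_area_gt0 : 0 < disc_area.
Proof. by rewrite -lte_fin -disc_areaE leb2_disc1_gt0. Qed.

Lemma leb2_disc t : leb2 (disc t) = (disc_area * Num.max 0 t)%:E.
Proof.
have [t0|t0] := ltP 0 t.
  by rewrite leb2_disc_scale // disc_areaE -EFinM mulrC.
rewrite mulr0; apply/eqP; rewrite eq_le measure_ge0 andbT.
apply/lee_addgt0Pr => e e0; rewrite add0e.
(* For [t <= 0] the disc lies in the disc of parameter [e / disc_area], whose measure is the
   arbitrarily small [e]. *)
have s0 : 0 < e / disc_area by rewrite divr_gt0 // disc_area_gt0.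
apply: (@le_trans _ _ (leb2 (disc (e / disc_area)))).
  apply: le_measure; [apply: mem_set; exact: measurable_disc.. | move=> z].
  by rewrite /disc /= => /le_trans; apply; apply: le_trans t0 (ltW s0).
by rewrite leb2_disc_scale // disc_areaE -EFinM divfK // lt0r_neq0 // disc_area_gt0.
Qed.

Lemma polydisk_disc a b : rvec (R := R) @^-1` polydisk a b = disc a `*` disc b.
Proof. by apply/funext => -[[x y] [z w]]; rewrite /polydisk /disc /radius2 /= !mxE. Qed.

Lemma measurable_polydisk a b : measurable (rvec (R := R) @^-1` polydisk a b).
Proof. by rewrite polydisk_disc; apply: measurableX; exact: measurable_disc. Qed.

Lemma leb4_polydisk a b : 0 <= a -> 0 <= b ->
  leb4 (rvec (R := R) @^-1` polydisk a b) = (disc_area ^+ 2 * (a * b))%:E.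
Proof.
move=> a0 b0; rewrite polydisk_disc [LHS]prod_measureX; [|exact: measurable_disc..].
apply: (eq_trans (congr2 _ (leb2_disc _) (leb2_disc _))).
by rewrite !max_r // -EFinM; congr EFin; ring.
Qed.

Lemma ellipsoid_radius a b : rvec (R := R) @^-1` ellipsoid a b =
  [set p | radius2 p.1 / a + radius2 p.2 / b <= 1].
Proof. by apply/funext => -[[x y] [z w]]; rewrite /ellipsoid /radius2 /= !mxE. Qed.

Lemma measurable_ellipsoid a b : measurable (rvec (R := R) @^-1` ellipsoid a b).
Proof.
rewrite ellipsoid_radius; apply: measurable_sublevel.
by apply: measurable_funD; apply: measurable_funM => //;
  exact: measurableT_comp measurable_radius2 _.
Qed.

Let integral_onem : (\int[leb]_(s in `[0%R, 1%R]) (1 - s)%:E = (2^-1)%:E :> \bar R)%E.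
Proof.
have := @Rintegral_onemXn R 1; rewrite /Rintegral.
under eq_integral do rewrite expr1 /unstable.onem.
(* An infinite integral is excluded because [fine] would send it to 0. *)
case: (integral _ _ _) => [x||] /=; first by move=> ->.
  by move/eqP; rewrite eq_sym invr_eq0 pnatr_eq0.
by move/eqP; rewrite eq_sym invr_eq0 pnatr_eq0.
Qed.

(* Both sides are the measure of the solid [0 <= s <= 1 - radius2 w], sliced
   in the two possible ways. *)
Lemma integral_paraboloid :
  (\int[leb2]_w (Num.max 0 (1 - radius2 w))%:E = (disc_area / 2)%:E)%E.
Proof.
pose S : set (T2 * mR) := [set p | 0 <= p.2] `&` [set p | radius2 p.1 + p.2 <= 1].
have mS : measurable S.
  apply: measurableI.
    rewrite (_ : [set _ | _] = [set p : T2 * mR | - p.2 <= 0]).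
      by apply: measurable_sublevel; exact: measurableT_comp.
    by apply/funext => p /=; rewrite oppr_le0.
  apply: measurable_sublevel; apply: measurable_funD => //.
  exact: measurableT_comp measurable_radius2 _.
transitivity (prod_measure leb2 leb S).
  apply: eq_integral => w _ /=.
  rewrite (_ : xsection S w = [set` `[0, 1 - radius2 w]]).
    rewrite lebesgue_measure_itv /= lte_fin -EFinD subr0.
    by case: ltP.
  rewrite xsectionE; apply/seteqP; split=> s; rewrite /S /= in_itv /= lerBrDl.
    by move=> [-> ->].
  by move=> /andP[-> ->].
rewrite prod_measure_ysection //.
transitivity (\int[leb]_(s in `[0%R, 1%R]) (disc_area%:E * (1 - s)%:E))%E; last first.
  rewrite ge0_integralZl_EFin ?integral_onem //.
  - by move=> s /=; rewrite in_itv /= lee_fin subr_ge0 => /andP[].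
  - by apply/measurable_EFinP; apply: measurable_funTS; exact: measurable_funB.
  - exact: ltW disc_area_gt0.
rewrite [RHS]integral_mkcond; apply: eq_integral => s _; rewrite patchE.
have [s0|s0] := leP 0 s; last first.
  rewrite memNset; last by rewrite /= in_itv /= leNgt s0.
  rewrite (_ : ysection S s = set0) ?measure0 //.
  by rewrite ysectionE; apply/seteqP; split=> // w; rewrite /S /= leNgt s0 => -[].
rewrite (_ : ysection S s = disc (1 - s)); last first.
  rewrite ysectionE; apply/seteqP; split=> w; rewrite /S /disc /= lerBrDr //.
  by case.
transitivity ((disc_area * Num.max 0 (1 - s))%:E); first exact: leb2_disc.
have [s1|s1] := leP s 1.
  by rewrite mem_set /= ?in_itv /= ?s0 // max_r // subr_ge0.
rewrite memNset; last by rewrite /= in_itv /= s0 leNgt s1.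
by rewrite max_l ?mulr0 // subr_le0 ltW.
Qed.

(** The slice over [w] is [disc (alpha * (1 - radius2 w))], so the volume is a multiple of the
    paraboloid integral. *)
Lemma leb4_ellipsoid (alpha : R) : 0 < alpha ->
  leb4 (rvec (R := R) @^-1` ellipsoid 1 alpha) = (disc_area ^+ 2 * (alpha / 2))%:E.
Proof.
move=> alpha0; have c0 := disc_area_gt0; rewrite ellipsoid_radius.
transitivity (\int[leb2]_w ((disc_area * alpha)%:E
    * (Num.max 0 (1 - radius2 w))%:E))%E.
  apply: eq_integral => w _ /=.
  rewrite (_ : xsection _ w = disc (alpha * (1 - radius2 w))).
    apply: (eq_trans (leb2_disc _)).
    rewrite -EFinM; congr EFin; rewrite -mulrA; congr (_ * _).
    by rewrite maxr_pMr ?mulr0 ?ltW.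
  rewrite xsectionE; apply/seteqP; split=> z; rewrite /disc /= divr1 -lerBrDl;
    by rewrite ler_pdivrMr // mulrC.
rewrite ge0_integralZl_EFin ?integral_paraboloid.
- by rewrite -EFinM; congr EFin; ring.
- by [].
- by move=> w _; rewrite lee_fin le_max lexx.
- apply/measurable_EFinP; apply: measurable_maxr => //.
  by apply: measurable_funB => //; exact: measurable_radius2.
- by rewrite mulr_ge0 ?ltW.
Qed.

End Volumes.

(** * Symplectic embeddings *)

Section Embeddings.
Variable R : realType.

Definition omega0_mx : 'M[R]_4 :=
  delta_mx 0 1 - delta_mx 1 0 + delta_mx 2 3 - delta_mx 3 2.

Lemma omega0E (u v : 'rV[R]_4) : omega0 u v = (u *m omega0_mx *m v^T) 0 0.
Proof.
rewrite mxE !big_ord_recl big_ord0 !mxE !big_ord_recl !big_ord0 !mxE /= /omega0.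
rewrite (_ : lift ord0 ord0 = 1 :> 'I_4); last exact: val_inj.
rewrite (_ : lift ord0 (lift ord0 ord0) = 2 :> 'I_4); last exact: val_inj.
rewrite (_ : lift ord0 (lift ord0 (lift ord0 ord0)) = 3 :> 'I_4); last exact: val_inj.
by rewrite /=; ring.
Qed.

Lemma omega0_mx_sqr : omega0_mx *m omega0_mx = - 1%:M.
Proof.
apply/matrixP => i j; case: (ord4P i) => ->; case: (ord4P j) => ->;
  by rewrite !mxE !big_ord_recl big_ord0 !mxE /=; ring.
Qed.

(** Determinants in A J A^T = J give det A ^ 2 = 1, since J^2 = -1 makes J invertible. *)
Lemma symplectic_det (A : 'M[R]_4) :
  (forall u v : 'rV[R]_4, omega0 (u *m A) (v *m A) = omega0 u v) -> `|\det A| = 1.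
Proof.
move=> sympl; have AJA : A *m omega0_mx *m A^T = omega0_mx.
  apply/matrixP => i j; have := sympl (delta_mx 0 i) (delta_mx 0 j).
  have entry (B : 'M[R]_4) :
    ((delta_mx 0 i : 'rV_4) *m B *m (delta_mx 0 j : 'rV_4)^T) 0 0 = B i j.
    transitivity ((row i B *m (delta_mx j 0 : 'cV_4)) 0 0); first by rewrite trmx_delta rowE.
    by rewrite -colE !mxE.
  by rewrite !omega0E trmx_mul !mulmxA entry => <-; rewrite -entry !mulmxA.
have J0 : \det omega0_mx != 0.
  have : \det (omega0_mx *m omega0_mx) != 0.
    by rewrite omega0_mx_sqr -scaleN1r scalemx1 det_scalar expf_neq0 // oppr_eq0 oner_neq0.
  by rewrite det_mulmx mulf_eq0 negb_or => /andP[].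
have := congr1 determinant AJA; rewrite !det_mulmx det_tr => h.
have A2 : \det A ^+ 2 = 1 by apply: (mulIf J0); rewrite mul1r -[RHS]h; ring.
by apply/eqP; rewrite -(@eqrXn2 _ 2) // real_normK ?num_real // A2 expr1n.
Qed.

Lemma radius_continuous (i j : 'I_4) :
  continuous (fun x : 'rV[R]_4 => pi * (x 0 i ^+ 2 + x 0 j ^+ 2)).
Proof.
move=> x.
have cX k : (fun x : 'rV[R]_4 => x 0 k ^+ 2) y @[y --> x] --> x 0 k ^+ 2.
  exact: (continuous_comp (@coord_continuous _ _ _ 0 k x) (@exprn_continuous R 2 _)).
exact: (cvgMl_tmp (cvgD (cX i) (cX j))).
Qed.

Lemma ellipsoid_compact (a b : R) : 0 < a -> 0 < b -> compact (ellipsoid a b).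
Proof.
move=> a0 b0; have p2 := pi_ge2 R; apply: bounded_closed_compact.
  (* Each squared coordinate is at most [a + b], because pi is at least 1, and x^2 <= s implies |x|
     <= 1 + s. *)
  exists (1 + a + b); split=> [|M /ltW leM x h /=]; first exact: num_real.
  apply: le_trans leM; move: h; rewrite /ellipsoid /= => h.
  have rad_le i j c d r : 0 < c -> 0 < d -> 0 <= r ->
      pi * (x 0 i ^+ 2 + x 0 j ^+ 2) / c + r / d <= 1 ->
      x 0 i ^+ 2 <= c /\ x 0 j ^+ 2 <= c.
    move=> c0 d0 r0 le1; have : pi * (x 0 i ^+ 2 + x 0 j ^+ 2) <= c.
      rewrite -[leRHS]mul1r -ler_pdivrMr //; apply: le_trans le1.
      by rewrite lerDl divr_ge0 // ltW.
    by have := sqr_ge0 (x 0 i); have := sqr_ge0 (x 0 j); split; nra.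
  have rad_ge0 i j : 0 <= pi * (x 0 i ^+ 2 + x 0 j ^+ 2).
    by rewrite mulr_ge0 ?pi_ge0 // addr_ge0 // sqr_ge0.
  have [x0 x1] := rad_le _ _ _ _ _ a0 b0 (rad_ge0 2 3) h.
  rewrite addrC in h; have [x2 x3] := rad_le _ _ _ _ _ b0 a0 (rad_ge0 0 1) h.
  apply: norm_le_coord => [|i]; first by rewrite !addr_ge0 ?ltW.
  have sq_le : x 0 i ^+ 2 <= a + b by case: (ord4P i) => ->; lra.
  by rewrite ler_norml; apply/andP; split; nra.
have cf : continuous (fun x : 'rV[R]_4 => pi * (x 0 0 ^+ 2 + x 0 1 ^+ 2) / a
    + pi * (x 0 2 ^+ 2 + x 0 3 ^+ 2) / b).
  move=> x; exact: (cvgD (cvgMr_tmp (@radius_continuous 0 1 x))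
    (cvgMr_tmp (@radius_continuous 2 3 x))).
exact: (closed_comp (fun x _ => cf x) (@closed_le _ 1)).
Qed.

Lemma polydisk_thickening (a b t : R) : 0 < a -> 0 < b -> 1 < t ->
  exists2 delta, 0 < delta & forall x y : 'rV[R]_4, polydisk a b x ->
    `|y - x| <= delta -> polydisk (t * a) (t * b) y.
Proof.
move=> a0 b0 t1; have p0 := pi_gt0 R; pose eta := (t - 1) / 2.
have eta0 : 0 < eta by rewrite divr_gt0 // subr_gt0.
(* Here [t] = 1 + 2 [eta]: one [eta] pays for stretching the old radius, the other for the additive
   error [C * delta] collected from two coordinates. *)
pose C := 2 * pi * (1 + eta^-1).
have C0 : 0 < C by rewrite !mulr_gt0 // addr_gt0 // invr_gt0.
pose m := Num.min a b; have m0 : 0 < m by rewrite lt_min a0.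
pose delta := Num.min 1 (eta * m / C).
have d0 : 0 < delta by rewrite lt_min ltr01 divr_gt0 // mulr_gt0.
have d1 : delta <= 1 by rewrite ge_min lexx.
have dC : C * delta <= eta * m by rewrite mulrC -ler_pdivlMr // ge_min lexx orbT.
(* Weighted form of (u + d)^2 <= (1 + eta) u^2 + (1 + 1/eta) d^2, from the square of u - d/eta;
   [delta <= 1] turns d^2 into [delta]. *)
have coord (u v : R) : `|v - u| <= delta ->
    v ^+ 2 <= (1 + eta) * u ^+ 2 + (1 + eta^-1) * delta.
  move=> vu; set d := v - u in vu; have -> : v = u + d by rewrite /d addrC subrK.
  have d2 : d ^+ 2 <= delta.
    rewrite -real_normK ?num_real // expr2.
    by apply: le_trans (_ : delta * delta <= _); [apply: ler_pM | rewrite ler_piMl // ltW].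
  have sq : 0 <= eta * (u - eta^-1 * d) ^+ 2 by rewrite mulr_ge0 ?sqr_ge0 // ltW.
  have sqE : eta * (u - eta^-1 * d) ^+ 2 = eta * u ^+ 2 - 2 * u * d + eta^-1 * d ^+ 2.
    by field; rewrite lt0r_neq0.
  have i0 : 0 < eta^-1 by rewrite invr_gt0.
  have le2 : (1 + eta^-1) * d ^+ 2 <= (1 + eta^-1) * delta by rewrite ler_pM2l // addr_gt0.
  by rewrite sqE in sq; apply: le_trans (lerD (lexx _) le2); rewrite sqrrD; lra.
have pair (c u1 u2 v1 v2 : R) : m <= c -> `|v1 - u1| <= delta -> `|v2 - u2| <= delta ->
    pi * (u1 ^+ 2 + u2 ^+ 2) <= c -> pi * (v1 ^+ 2 + v2 ^+ 2) <= t * c.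
  move=> mc /coord h1 /coord h2 hc.
  have h : pi * (v1 ^+ 2 + v2 ^+ 2) <= (1 + eta) * (pi * (u1 ^+ 2 + u2 ^+ 2)) + C * delta.
    apply: (@le_trans _ _ (pi * ((1 + eta) * u1 ^+ 2 + (1 + eta^-1) * delta
      + ((1 + eta) * u2 ^+ 2 + (1 + eta^-1) * delta)))).
      by rewrite ler_pM2l // lerD.
    by rewrite le_eqVlt; apply/orP; left; apply/eqP; rewrite /C; ring.
  have -> : t * c = (1 + eta) * c + eta * c by rewrite /eta; field.
  apply: (le_trans h); apply: lerD; first by rewrite ler_pM2l // addr_gt0.
  by apply: (le_trans dC); rewrite ler_pM2l.
exists delta => // x y [xw xz] yx.
have yxi i : `|y 0 i - x 0 i| <= delta.
  by have := le_trans (coord_le_norm (y - x) i) yx; rewrite !mxE.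
by split; apply: pair; [| exact: yxi | exact: yxi | exact: xw | | exact: yxi
  | exact: yxi | exact: xz]; rewrite ge_min lexx ?orbT.
Qed.

Lemma Ck_on_cst k (U : set 'rV[R]_4) v : Ck_on k U (fun _ : 'rV[R]_4 => v).
Proof.
elim: k v => [|k IH] v /=; first by move=> x _; exact: cst_continuous.
split=> [x _|w]; first exact: differentiable_cst.
have -> : (fun x => 'D_w (fun _ : 'rV[R]_4 => v) x) = fun=> 0; last exact: IH.
by apply/funext => x; rewrite derive_cst.
Qed.

Lemma smooth_on_id (U : set 'rV[R]_4) : smooth_on U id.
Proof.
case=> [|k] /=; first by move=> x _; exact: cvg_id.
split=> [x _|v]; first exact: ex_diff.
have -> : (fun x => 'D_v (@id 'rV[R]_4) x) = fun=> v; last exact: Ck_on_cst.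
by apply/funext => x; rewrite derive_id.
Qed.

(** Inclusions supply the embedding showing that the infimum in the capacity is over a nonempty
    set. *)
Lemma symplectic_embedding_id (X Y : set 'rV[R]_4) :
  X `<=` Y -> symplectic_embedding X Y id.
Proof.
move=> XY; split=> //.
- by exists setT; split=> //; [exact: openT | exact: smooth_on_id].
- move=> x _ u v; have dE w : 'd (@id 'rV[R]_4) x w = w by rewrite diff_val.
  by rewrite !dE.
Qed.

(** The covering bound costs [t ^+ 4] and enlarging the polydisk costs [t ^+ 2]; then [t] tends to
    1. *)
Lemma embedding_volume (alpha a b : R) f : 0 < alpha -> 0 < a -> 0 < b ->
  symplectic_embedding (ellipsoid 1 alpha) (polydisk a b) f ->
  alpha / 2 <= a * b.
Proof.
move=> alpha0 a0 b0 [[U [oU XU /(_ 1%N)[fU _]]] finj fsympl fXY].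
have main (t : R) : 1 < t -> alpha / 2 <= t ^+ 6 * (a * b).
  move=> t1; have t0 := lt_trans ltr01 t1.
  have [delta d0 dP] := polydisk_thickening a0 b0 t1.
  have c0 := disc_area_gt0 R.
  have detf x : ellipsoid 1 alpha x -> `|\det (lin1_mx ('d f x))| = 1.
    by move=> xE; apply: symplectic_det => u v; rewrite !mul_rV_lin1 /= fsympl.
  have := leb4_le_image t1 d0 (ellipsoid_compact ltr01 alpha0)
    (measurable_ellipsoid 1 alpha) (measurable_polydisk (t * a) (t * b))
    (fun x xE => fU x (XU x xE)) finj detf
    (fun x y xE => dP (f x) y (fXY x xE)).
  rewrite leb4_ellipsoid // leb4_polydisk; [|by rewrite mulr_ge0 // ltW..].
  rewrite -EFinM lee_fin.
  rewrite [leRHS]mulrCA ler_pM2l ?exprn_gt0 // => /le_trans; apply.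
  by rewrite le_eqVlt; apply/orP; left; apply/eqP; ring.
apply/ler_addgt0Pr => e e0; have ab0 : 0 < a * b by rewrite mulr_gt0.
(* With [t = 1 + s] and [s <= 1], the number 63 = 2^6 - 1 is the sum of the binomial coefficients of
   the nonconstant terms of (1 + s)^6. *)
pose s := Num.min 1 (e / (63 * (a * b))).
have s0 : 0 < s by rewrite lt_min ltr01 divr_gt0 // mulr_gt0.
have s1 : s <= 1 by rewrite ge_min lexx.
have se : s * (63 * (a * b)) <= e by rewrite -ler_pdivlMr ?mulr_gt0 // ge_min lexx orbT.
have sX k : s ^+ k.+1 <= s by rewrite exprS ler_piMr ?exprn_ile1 // ltW.
have t6 : (1 + s) ^+ 6 <= 1 + 63 * s.
  have -> : (1 + s) ^+ 6 = 1 + 6 * s + 15 * s ^+ 2 + 20 * s ^+ 3 + 15 * s ^+ 4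
    + 6 * s ^+ 5 + s ^+ 6 by ring.
  by have := sX 1; have := sX 2; have := sX 3; have := sX 4; have := sX 5; lra.
apply: (le_trans (main (1 + s) _)); first by rewrite ltrDl.
apply: (@le_trans _ _ ((1 + 63 * s) * (a * b))); first by rewrite ler_pM2r.
by rewrite mulrDl mul1r lerD2l -[63 * s]mulrC -mulrA.
Qed.

End Embeddings.

(** * Lower bound on the capacity and conclusion *)

Lemma ellipsoid_sub_polydisk (R : realType) (alpha lambda beta : R) :
  0 < alpha -> 1 <= lambda -> alpha <= lambda * beta ->
  ellipsoid 1 alpha `<=` polydisk lambda (lambda * beta).
Proof.
move=> alpha0 l1 al x; rewrite /ellipsoid /polydisk /= divr1.
have rad_ge0 i j : 0 <= pi * (x 0 i ^+ 2 + x 0 j ^+ 2).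
  by rewrite mulr_ge0 ?pi_ge0 // addr_ge0 // sqr_ge0.
set u := pi * (_ + _ ^+ 2); set v := pi * _ => h.
have u0 : 0 <= u by exact: rad_ge0.
have v0 : 0 <= v by exact: rad_ge0.
have va0 : 0 <= v / alpha by rewrite divr_ge0 // ltW.
split; first by apply: le_trans l1; lra.
apply: le_trans al; rewrite -[leRHS]mul1r -ler_pdivrMr //; lra.
Qed.

Lemma sqrt_le_embedding_capacity (R : realType) (alpha beta : R) :
  0 < alpha -> 0 < beta ->
  Num.sqrt (alpha / (2 * beta)) <= embedding_capacity beta alpha.
Proof.
move=> alpha0 beta0; apply: lb_le_inf.
  (* For this [lambda] the ellipsoid is contained in the polydisk, so the infimum is a genuine
     one. *)
  exists (Num.max 1 (alpha / beta)); split; first by rewrite lt_max ltr01.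
  exists id; apply: symplectic_embedding_id; apply: ellipsoid_sub_polydisk => //.
    by rewrite le_max lexx.
  by rewrite -ler_pdivrMr // le_max lexx orbT.
move=> lambda [lambda0 [f fE]].
have := embedding_volume alpha0 lambda0 (mulr_gt0 lambda0 beta0) fE => vol.
rewrite -(ger0_norm (ltW lambda0)) -sqrtr_sqr ler_wsqrtr //.
rewrite ler_pdivrMr ?mulr_gt0 //; move: vol; rewrite ler_pdivrMr // => vol.
by apply: (le_trans vol);
  rewrite le_eqVlt; apply/orP; left; apply/eqP; ring.
Qed.

Unset Implicit Arguments.

Theorem corollary4p12 (R : realType) (n i : nat) (hn : (2 <= n)%N) :
  Num.sqrt (alpha_in R n i / (2 * Ln0 R n))
    <= embedding_capacity (Ln0 R n) (alpha_in R n i)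
  /\ (ereal_sup [set (Gamma (alpha_in R n i) (Ln0 R n) n j)%:E | j in [set: nat]]
      < (Num.sqrt (alpha_in R n i / (2 * Ln0 R n)))%:E)%E.
Proof.
split; last exact: ereal_sup_Gamma_lt.
by apply: sqrt_le_embedding_capacity; [exact: alpha_in_gt0 | exact: Ln0_gt0].
Qed.
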